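(* Let $n$ be the number of vertices, $\rho>0$, and let $\mathcal A_{sub\text{-}MM}$ be the randomized algorithm described in the context. Then the coupled global sensitivity of $\mathcal A_{sub\text{-}MM}$ with respect to node-neighboring graphs satisfies $CGS^v_{\mathcal A_{sub\text{-}MM}}\le\frac{n\rho^2}{16\cdot 24\ln n}$.
   Context: Graphs are simple and undirected on a common vertex set $V$, $|V|=n$. Node-neighboring graphs $G_1,G_2$: there is a vertex $v$ such that the edge sets induced on $V\setminus\{v\}$ coincide. Greedy maximal matching w.r.t. a ranking $\pi$ (a bijection from the set of unordered pairs of distinct vertices to $\{1,\dots,\binom n2\}$): process pairs in increasing order of $\pi$, adding a pair if it is an edge and both endpoints are unmatched. Algorithm $\mathcal A_{sub\text{-}MM}$ on input $G$: choose $\pi$ uniformly at random; sample $s=16\cdot24(\ln n)/\rho^2$ vertices $v_1,\dots,v_s$ uniformly without replacement; let $X_i=1$ if $v_i$ is an endpoint of an edge of the greedy maximal matching of $G$ w.r.t. $\pi$, else $X_i=0$; output $\frac{n}{2s}\sum_{i=1}^sX_i-\frac{\rho n}{2}$. For couplings: a coupling of random variables $Z,Z'$ is a joint variable with marginals $Z$ and $Z'$; $\mathsf{Couple}(Z,Z')$ is the set of couplings. $CGS^v_{\mathcal A}:=\max_{G_1\sim G_2}\min_{C\in\mathsf{Couple}(\mathcal A(G_1),\mathcal A(G_2))}\max_{(z,z')\in C}|z-z'|$, with the outer maximum over node-neighboring pairs. *)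

(* Defs.v *)
From HB Require Import structures.
From mathcomp Require Import all_boot all_order all_algebra.
From mathcomp Require Import all_classical all_reals all_analysis.

Set Implicit Arguments.
Unset Strict Implicit.
Unset Printing Implicit Defensive.

Import Order.TTheory GRing.Theory Num.Theory.
Import numFieldNormedType.Exports.

Local Open Scope classical_set_scope.
Local Open Scope ring_scope.

Section uniform_law.
Local Open Scope ereal_scope.
Context (R : realType) (d : measure_display) (T : measurableType d).
Variables (W : finType) (f : W -> T).

(* The law of [f w] for [w] uniform in [W]; the proof argument, as in
   [uniform_prob], makes the result a probability. *)
Definition uniform_law of (0 < #|W|)%N := fun A : set T =>
  (#|W|%:R^-1)%:E * \sum_(w : W) \d_(f w) A : \bar R.

Variable W_gt0 : (0 < #|W|)%N.
Let mu := uniform_law W_gt0.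

Let uniform_law0 : mu set0 = 0.
Proof. by rewrite /mu /uniform_law big1 ?mule0// => w _; rewrite measure0. Qed.

Let uniform_law_ge0 A : 0 <= mu A.
Proof. by rewrite mule_ge0 ?lee_fin ?invr_ge0// sume_ge0. Qed.

Let uniform_law_sigma_additive : semi_sigma_additive mu.
Proof.
move=> F mF tF mUF; rewrite [X in X @ \oo --> _](_ : _ = (fun n =>
    (#|W|%:R^-1)%:E * \sum_(w : W) \sum_(0 <= i < n) \d_(f w) (F i))); last first.
  apply/funext => k; rewrite exchange_big/= ge0_sume_distrr// => i _.
  exact: sume_ge0.
apply: cvgeZl => //; apply: cvg_nnesum => // w _.
  by near=> n; exact: sume_ge0.
exact: measure_semi_sigma_additive.
Unshelve. all: by end_near. Qed.

HB.instance Definition _ := isMeasure.Build _ _ _ (uniform_law W_gt0)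
  uniform_law0 uniform_law_ge0 uniform_law_sigma_additive.

Let uniform_law_setT : uniform_law W_gt0 setT = 1.
Proof.
rewrite /uniform_law (eq_bigr (fun=> 1%:E)); last by move=> w _; rewrite diracT.
rewrite sumEFin -EFinM sumr_const cardT -cardE mulVf//.
by rewrite pnatr_eq0 -lt0n.
Qed.

HB.instance Definition _ := Measure_isProbability.Build _ _ _
  (uniform_law W_gt0) uniform_law_setT.

End uniform_law.

Section graphs.
Variable V : finType.

Definition vpair := {e : {set V} | #|e| == 2}.

(* A simple graph on [V], given by its edge set. *)
Definition sgraph := {set vpair}.

Definition node_neighbors (G1 G2 : sgraph) : Prop :=
  exists v : V, [set e in G1 | v \notin val e]%SET =
                [set e in G2 | v \notin val e]%SET.

(* Ranks start at 0 instead of 1: only their order matters. *)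
Definition ranking :=
  {p : {ffun vpair -> 'I_('C(#|V|, 2))} | `[< bijective p >]}.

Definition matched (M : {set vpair}) (x : V) : bool :=
  [exists e in M, x \in val e].

Definition greedy_step (G M : {set vpair}) (e : vpair) : {set vpair} :=
  if (e \in G) && [forall x in val e, ~~ matched M x]
  then (e |: M)%SET else M.

Definition greedy_matching (p : ranking) (G : sgraph) : {set vpair} :=
  foldl (greedy_step G) finset.set0
    (sort (fun e e' : vpair => (val p e <= val p e')%N) (enum {: vpair})).

(* Ordered samples (v_1, ..., v_s) without replacement. *)
Definition vsample (s : nat) := {t : s.-tuple V | uniq t}.

Lemma ranking_gt0 : (0 < #|{: ranking}|)%N.
Proof.
have cE : #|{: vpair}| = 'C(#|V|, 2).
  rewrite card_sig -(cardsT V) -(cards_draws [set: V]%SET 2).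
  rewrite cardsE; apply: eq_card => e.
  by rewrite [RHS]unfold_in finset.subsetT.
pose f : {ffun vpair -> 'I_('C(#|V|, 2))} :=
  [ffun e => cast_ord cE (enum_rank e)].
have fb : `[< bijective f >].
  apply/asboolP; exists (fun i => enum_val (cast_ord (esym cE) i)) => x.
    by rewrite ffunE cast_ordK enum_rankK.
  by rewrite ffunE enum_valK cast_ordKV.
by apply/card_gt0P; exists (exist _ f fb).
Qed.

Lemma vsample_gt0 s : (s <= #|V|)%N -> (0 < #|{: vsample s}|)%N.
Proof.
move=> sV; have sz : size (take s (enum V)) == s.
  by rewrite size_takel// -cardE.
have u : uniq (Tuple sz) by rewrite /= take_uniq// enum_uniq.
by apply/card_gt0P; exists (exist _ (Tuple sz) u).
Qed.

Definition seed (s : nat) := (ranking * vsample s)%type.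

Lemma seed_gt0 s : (s <= #|V|)%N -> (0 < #|{: seed s}|)%N.
Proof. by move=> sV; rewrite card_prod muln_gt0 ranking_gt0 vsample_gt0. Qed.

End graphs.

Section coupled_global_sensitivity.
Local Open Scope ereal_scope.
Context {R : realType}.

Definition couple (mu nu : probability R R) : set (probability (R * R)%type R) :=
  [set C | forall A : set R, measurable A ->
     C (fst @^-1` A) = mu A /\ C (snd @^-1` A) = nu A].

(* The support of [C]; when [C] is discrete with finitely many values, these
   are the pairs of positive probability. *)
Definition coupling_support (C : probability (R * R)%type R) : set (R * R) :=
  [set z | forall U : set (R * R), open U -> U z -> 0 < C U].

Definition coupling_dist (C : probability (R * R)%type R) : \bar R :=
  ereal_sup [set (`|z.1 - z.2|%R)%:E | z in coupling_support C].

(* Max and min are written as sup and inf in the extended reals; for an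
   algorithm with finitely many inputs and outputs they are attained. *)
Definition CGS (X : Type) (nbr : X -> X -> Prop) (A : X -> probability R R) :
    \bar R :=
  ereal_sup [set ereal_inf [set coupling_dist C | C in couple (A G.1) (A G.2)]
            | G in [set G : X * X | nbr G.1 G.2]].

End coupled_global_sensitivity.

Section sub_MM.
Context {R : realType}.
Variables (V : finType) (rho : R).

(* The sample size is an integer, hence the rounding up. *)
Definition nsamples : nat :=
  `|Num.ceil (16 * 24 * ln (#|V|%:R : R) / rho ^+ 2)|%N.

Definition sub_MM_output (G : sgraph V) (w : seed V nsamples) : R :=
  #|V|%:R / (2 * nsamples%:R)
    * \sum_(i < nsamples) (matched (greedy_matching w.1 G) (tnth (val w.2) i))%:R
  - rho * #|V|%:R / 2.

(* Sampling without replacement requires [nsamples <= #|V|]. *)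
Definition sub_MM (sV : (nsamples <= #|V|)%N) (G : sgraph V) :
    probability R R :=
  uniform_law R (sub_MM_output G) (seed_gt0 sV).

End sub_MM.

(* Main.v *)
Require Import Defs.
From HB Require Import structures.
From mathcomp Require Import all_boot all_order all_algebra.
From mathcomp Require Import all_classical all_reals all_analysis.
From mathcomp Require Import zify.

(** Run the algorithm on both graphs with the same random seed. Let [v] be the
    vertex at which the graphs differ and let [S1], [S2] be the sets of vertices
    matched so far by the two greedy processes. Then [S1] and [S2] differ in at
    most two vertices, and coincide as long as [v] is unmatched in both: when
    only the first process adds a pair [e], the symmetric difference [D] becomes
    [D + e], and either [e] meets [D], so that [D] does not grow, or [e] is a
    pair at [v] and [D] was empty. Hence the two outputs differ by at most
    [n / (2 s) * 2]. *)

Set Implicit Arguments.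
Unset Strict Implicit.
Unset Printing Implicit Defensive.

Import Order.TTheory GRing.Theory Num.Theory.
Import numFieldNormedType.Exports.

Local Open Scope ring_scope.

Section symmetric_difference.
Variable T : finType.
Implicit Types A B e : {set T}.

Definition symdiff A B : {set T} := ((A :\: B) :|: (B :\: A))%SET.

Lemma in_symdiff A B x : (x \in symdiff A B) = ((x \in A) (+) (x \in B)).
Proof. by rewrite !inE; case: (x \in A); case: (x \in B). Qed.

Lemma symdiffC A B : symdiff A B = symdiff B A.
Proof. by apply/setP => x; rewrite !in_symdiff addbC. Qed.

Lemma symdiffUl A B e : [disjoint e & A] ->
  symdiff (A :|: e)%SET B = symdiff (symdiff A B) e.
Proof.
move=> eA; apply/setP => x; rewrite !in_symdiff inE.
by case: (boolP (x \in e)) => [/(disjointFr eA)->|]; case: (x \in A); case: (x \in B).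
Qed.

Lemma symdiffU2 A B e : [disjoint e & A] -> [disjoint e & B] ->
  symdiff (A :|: e)%SET (B :|: e)%SET = symdiff A B.
Proof.
move=> eA eB; apply/setP => x; rewrite !in_symdiff !inE.
by case: (boolP (x \in e)) => [xe|]; rewrite ?orbF // (disjointFr eA) // (disjointFr eB).
Qed.

(** At least one of the two elements of [e] is removed from [A], so at most one is added. *)
Lemma card_symdiff_le A e x : #|e| = 2 -> x \in e -> x \in A ->
  (#|symdiff A e| <= #|A|)%N.
Proof.
move=> e2 xe xA; have : (0 < #|A :&: e|)%N.
  by apply/card_gt0P; exists x; rewrite inE xA.
have := cardsID e A; have := cardsID A e; rewrite finset.setIC e2.
have := (leq_card_setU (A :\: e)%SET (e :\: A)%SET).1; rewrite -/(symdiff A e).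
lia.
Qed.

End symmetric_difference.

Section greedy.
Variable V : finType.
Implicit Types (G M : {set vpair V}) (e : vpair V) (v : V).

Definition matched_set M : {set V} := [set x | matched M x]%SET.

Lemma matched_setU1 e M : matched_set (e |: M)%SET = (matched_set M :|: val e)%SET.
Proof.
apply/setP => x; rewrite !inE; apply/existsP/orP => [[f]|[/existsP[f]|xe]].
- rewrite !inE => /andP[/orP[/eqP->|fM] xf]; [by right|left].
  by apply/existsP; exists f; rewrite fM.
- by move=> /andP[fM xf]; exists f; rewrite !inE fM orbT.
- by exists e; rewrite !inE eqxx.
Qed.

Lemma matched_set_greedy_step G M e :
  matched_set (greedy_step G M e) =
  if (e \in G) && [disjoint val e & matched_set M]
  then (matched_set M :|: val e)%SET else matched_set M.
Proof.
rewrite /greedy_step.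
have -> : [forall x in val e, ~~ matched M x] = [disjoint val e & matched_set M].
  rewrite disjoint_subset; apply/forall_inP/fintype.subsetP => H x xe;
  by have := H x xe; rewrite !inE.
by case: ifP => // _; rewrite matched_setU1.
Qed.

(** The cardinality bound alone is not inductive: a pair at [v] can put two new vertices into the
    difference. The second clause ensures that the difference is empty beforehand. *)
Definition nearly_equal v (S1 S2 : {set V}) : Prop :=
  (#|symdiff S1 S2| <= 2)%N /\ (v \notin S1 -> v \notin S2 -> S1 = S2).

Lemma nearly_equalC v (S1 S2 : {set V}) :
  nearly_equal v S1 S2 -> nearly_equal v S2 S1.
Proof. by case=> D2 E; split; [rewrite symdiffC|move=> v2 v1; rewrite E]. Qed.

(** The case where only the first process adds [e]. The disjunction lists why the second may skip
    it: the pair touches [v], or one of its endpoints is already matched. *)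
Lemma nearly_equal_setU v (S1 S2 e : {set V}) : #|e| = 2 -> [disjoint e & S1] ->
  v \in e \/ (exists2 x, x \in e & x \in S2) ->
  nearly_equal v S1 S2 -> nearly_equal v (S1 :|: e)%SET S2.
Proof.
move=> e2 eS1 h [D2 E]; split.
  have [/exists_inP[x xe xS2]|] := boolP [exists x in e, x \in S2].
    (* [x] lies in [S2] but not in [S1], so [e] meets the old difference, which cannot grow. *)
    rewrite symdiffUl// (leq_trans (card_symdiff_le (x := x) _ _ _))//.
    by rewrite in_symdiff xS2 (disjointFr eS1).
  move=> /exists_inPn eS2; case: h => [ve|[x xe xS2]]; last first.
    by have := eS2 x xe; rewrite xS2.
  (* Here [v] lies in [e], which avoids both sets; hence [S1 = S2] and only [e] remains. *)
  have -> : symdiff (S1 :|: e)%SET S2 = e; last by rewrite e2.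
  rewrite (E _ (eS2 v ve)) ?(disjointFr eS1)//.
  apply/setP => x; rewrite in_symdiff inE.
  by case: (boolP (x \in e)) => [/eS2/negPf->//|_]; rewrite orbF addbb.
(* With [v] outside [e], some [x] in [e] would lie in [S2 = S1], which [e] avoids. *)
rewrite inE negb_or => /andP[v1 ve] v2; case: h => [|[x xe]]; first by rewrite (negPf ve).
by rewrite -(E v1 v2) (disjointFr eS1).
Qed.

Lemma nearly_equal_greedy_step v G1 G2 M1 M2 e :
  [set f in G1 | v \notin val f]%SET = [set f in G2 | v \notin val f]%SET ->
  nearly_equal v (matched_set M1) (matched_set M2) ->
  nearly_equal v (matched_set (greedy_step G1 M1 e))
                 (matched_set (greedy_step G2 M2 e)).
Proof.
move=> G12 M12; have e2 : #|val e| = 2 by exact/eqP/(valP e).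
(* Generic in the graphs, to serve both asymmetric cases. The graphs agree away from [v], so a
   rejected pair avoiding [v] has an endpoint in [S]. *)
have onlyone G G' (S : {set V}) :
    [set f in G | v \notin val f]%SET = [set f in G' | v \notin val f]%SET ->
    e \in G -> (e \in G') && [disjoint val e & S] = false ->
    v \in val e \/ (exists2 x, x \in val e & x \in S).
  move=> /setP/(_ e); rewrite !inE => + eG; rewrite eG /=.
  case: (boolP (v \in val e)) => [|_ /=]; first by left.
  rewrite andbT => <- /= /negbT /pred0Pn[x /andP[/= xe xS]].
  by right; exists x.
rewrite !matched_set_greedy_step.
case: ifP => [/andP[eG1 d1]|n1]; case: ifP => [/andP[eG2 d2]|n2] //.
- case: M12 => D2 E; split; first by rewrite symdiffU2.
  by rewrite !finset.in_setU !negb_or => /andP[v1 _] /andP[v2 _]; rewrite E.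
- by apply: nearly_equal_setU => //; exact: (onlyone _ _ _ G12 eG1 n2).
- apply/nearly_equalC/nearly_equal_setU => //; last exact: nearly_equalC.
  exact: (onlyone _ _ _ (esym G12) _ n1).
Qed.

Lemma card_symdiff_greedy (p : ranking V) (G1 G2 : sgraph V) :
  node_neighbors G1 G2 ->
  (#|symdiff (matched_set (greedy_matching p G1))
             (matched_set (greedy_matching p G2))| <= 2)%N.
Proof.
case=> v G12; suff [] : nearly_equal v (matched_set (greedy_matching p G1))
    (matched_set (greedy_matching p G2)) by [].
have foldl_near s M1 M2 : nearly_equal v (matched_set M1) (matched_set M2) ->
    nearly_equal v (matched_set (foldl (greedy_step G1) M1 s))
                   (matched_set (foldl (greedy_step G2) M2 s)).
  elim: s M1 M2 => //= e s IH M1 M2 M12.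
  by apply: IH; exact: nearly_equal_greedy_step.
by apply: foldl_near; split=> //; rewrite /symdiff finset.setDv finset.setU0 cards0.
Qed.

End greedy.

(** Each position contributes the indicator of the symmetric difference, and a sample without
    repetition counts each vertex at most once. *)
Lemma dist_sum_uniq_le (R : realType) (V : finType) (s : nat) (t : s.-tuple V)
    (A B : {set V}) : uniq t ->
  `|\sum_(i < s) (tnth t i \in A)%:R - \sum_(i < s) (tnth t i \in B)%:R|
    <= #|symdiff A B|%:R :> R.
Proof.
move=> ut; rewrite -sumrB (le_trans (ler_norm_sum _ _ _))//.
rewrite (eq_bigr (fun i => (tnth t i \in symdiff A B)%:R)); last first.
  move=> i _; rewrite in_symdiff.
  by case: (_ \in A); case: (_ \in B); rewrite ?subrr ?normr0 ?subr0 ?sub0r ?normrN ?normr1.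
rewrite -natr_sum ler_nat.
rewrite -(big_tuple _ _ t predT (fun x => nat_of_bool (x \in symdiff A B))) /=.
rewrite big_uniq//= -sum1_card [leqRHS]big_mkcond [leqLHS]big_mkcond /=.
by apply: leq_sum => x _; case: (x \in t); case: (x \in symdiff A B).
Qed.

Lemma ln_card_gt0 (R : realType) (n : nat) : (1 < n)%N -> 0 < ln (n%:R : R).
Proof. by move=> n1; rewrite ln_gt0// ltr1n. Qed.

Lemma nsamples_ge (R : realType) (V : finType) (rho : R) : (1 < #|V|)%N ->
  16 * 24 * ln (#|V|%:R : R) / rho ^+ 2 <= (nsamples V rho)%:R.
Proof.
move=> V1; rewrite /nsamples natr_absz ger0_norm; first exact: ceil_ge.
(* A ceiling is nonnegative as soon as its argument exceeds [-1]. *)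
by rewrite ceil_ge0 (@lt_le_trans _ _ 0)// ?ltrN10// divr_ge0 ?sqr_ge0// mulr_ge0// ltW// ln_card_gt0.
Qed.

Local Open Scope classical_set_scope.

(** Supports are defined through open sets: a support point in this one would force it to have
    positive mass. *)
Lemma open_dist_gt (R : realType) (B : R) :
  open [set z : R * R | B < `|z.1 - z.2|].
Proof.
apply: (@open_comp _ _ (fun z : R * R => `|z.1 - z.2|) [set x | B < x]).
  move=> z _; apply: (continuous_comp (f := fun z : R * R => z.1 - z.2)).
    by apply: cvgB; [exact: cvg_fst | exact: cvg_snd].
  exact: norm_continuous.
exact: open_gt.
Qed.

Lemma uniform_law_eq0 (R : realType) (d : measure_display)
    (T : measurableType d) (W : finType) (W_gt0 : (0 < #|W|)%N) (f : W -> T)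
    (A : set T) :
  (forall w, ~ A (f w)) -> uniform_law R f W_gt0 A = 0%E.
Proof.
move=> fA; rewrite /uniform_law big1 ?mule0// => w _.
by rewrite diracE memNset.
Qed.

Lemma CGS_uniform_law_le (R : realType) (X : Type) (nbr : X -> X -> Prop)
    (W : finType) (W_gt0 : (0 < #|W|)%N) (f : X -> W -> R) (B : R) :
  (forall x y, nbr x y -> forall w, `|f x w - f y w| <= B) ->
  (CGS nbr (fun x => uniform_law R (f x) W_gt0) <= B%:E)%E.
Proof.
move=> fB; apply: ge_ereal_sup => _ [[x y] /= xy <-].
(* Both runs share the seed [w]. The marginals hold by computation: a Dirac mass at a pair,
   evaluated on the preimage under a projection, is the Dirac mass at that component. *)
pose C : probability (R * R)%type R :=
  uniform_law R (fun w => (f x w, f y w)) W_gt0.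
apply: (@le_trans _ _ (coupling_dist C)).
  by apply: ereal_inf_lbound; exists C.
apply: ge_ereal_sup => _ [z zC <-]; rewrite lee_fin leNgt; apply/negP => Bz.
have := zC _ (@open_dist_gt R B) Bz.
rewrite /C/= uniform_law_eq0 ?ltxx// => w /=.
by apply/negP; rewrite -leNgt fB.
Qed.

Theorem theorem8 (R : realType) (V : finType) (rho : R)
    (n_gt1 : (1 < #|V|)%N) (rho_gt0 : 0 < rho)
    (sV : (nsamples V rho <= #|V|)%N) :
  (CGS (@node_neighbors V) (sub_MM sV)
     <= (#|V|%:R * rho ^+ 2 / (16 * 24 * ln (#|V|%:R : R)))%:E)%E.
Proof.
apply: CGS_uniform_law_le => G1 G2 G12 [p t].
rewrite /sub_MM_output /=; set s := nsamples V rho.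
have x_gt0 : 0 < 16 * 24 * ln (#|V|%:R : R) / rho ^+ 2.
  by rewrite divr_gt0 ?exprn_gt0// mulr_gt0// ln_card_gt0.
have xs := nsamples_ge rho n_gt1; rewrite -/s in xs.
have s_gt0 : 0 < s%:R :> R by exact: lt_le_trans xs.
have c_ge0 : 0 <= #|V|%:R / (2 * s%:R) :> R by rewrite divr_ge0// mulr_ge0.
have matchedE M x : matched M x = (x \in matched_set M) by rewrite inE.
under eq_bigr do rewrite matchedE.
under [in X in _ - X]eq_bigr do rewrite matchedE.
(* The shift [rho * n / 2] cancels and the common factor comes out. *)
rewrite opprB addrA subrK -mulrBr normrM ger0_norm//.
apply: (@le_trans _ _ (#|V|%:R / (2 * s%:R) * 2)).
  rewrite ler_wpM2l// (le_trans (dist_sum_uniq_le _ _ _ (valP t)))//.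
  by rewrite ler_nat card_symdiff_greedy.
have -> : #|V|%:R / (2 * s%:R) * 2 = #|V|%:R / s%:R :> R.
  by rewrite invfM mulrA mulrAC mulfVK.
(* Rounding up only enlarges [s], and inverting reverses [xs] since both sides are positive. *)
by rewrite -mulrA ler_wpM2l// -[leRHS]invf_div lef_pV2.
Qed.
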